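(* If $G$ is a graph of order $n$ containing the $16$-th power of a Hamiltonian cycle, then $s^-(G)\ge n-1$.
   Context: All graphs are finite and simple. For a graph $G$ with adjacency eigenvalues $\lambda_i(G)$, $s^-(G)=\sum_{\lambda_i(G)<0}\lambda_i(G)^2$. A $k$-th power of a Hamiltonian cycle in a graph $G$ of order $n$ is a bijection $\phi:\mathbb{Z}_n\to V(G)$ such that for every $i\in\mathbb{Z}_n$ and every $j\in\{1,\ldots,k\}$, the pair $\phi(i)\phi(i+j)$ is an edge of $G$. *)

(* Defs.v *)
From HB Require Import structures.
From mathcomp Require Import all_boot all_order all_algebra.
From mathcomp Require Import polyrcf reals.
Set Implicit Arguments.
Unset Strict Implicit.
Unset Printing Implicit Defensive.

Import Order.TTheory GRing.Theory Num.Theory.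
Local Open Scope ring_scope.

(* A finite simple graph is a symmetric irreflexive relation on a finType. *)

Definition adjacency_matrix (R : nzRingType) (V : finType) (e : rel V) :
    'M[R]_#|V| :=
  \matrix_(i, j) (e (enum_val i) (enum_val j))%:R.

(* The list of real roots of the characteristic polynomial, each repeated
   according to its multiplicity; [rootsR] itself lists every root once. *)
Definition real_eigenvalues (R : rcfType) (n : nat) (A : 'M[R]_n) : seq R :=
  flatten [seq nseq (mup x (char_poly A)) x | x <- rootsR (char_poly A)].

Definition s_minus (R : rcfType) (V : finType) (e : rel V) : R :=
  \sum_(x <- real_eigenvalues (adjacency_matrix R e) | x < 0) x ^+ 2.

(* The integers modulo the order of the graph are represented by their
   residues 'I_#|V|, and [i'] below is the residue of [i + j]. *)
Definition has_hamiltonian_cycle_power (V : finType) (e : rel V) (k : nat) :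
    Prop :=
  exists2 phi : 'I_#|V| -> V, bijective phi &
    forall (i i' : 'I_#|V|) (j : nat), (1 <= j <= k)%N ->
      i' = i + j %[mod #|V|] -> e (phi i) (phi i').

(* Main.v *)
(* For a symmetric matrix A and a positive semidefinite Y, the spectral theorem
   gives s^-(A) >= - 2 <A, Y> - <Y, Y>, and the right-hand side ("gain") is
   additive over matrices Y with disjoint supports.  The projection orthogonal
   to the all-ones vector of a clique of order m gains m - 1.  A clique of
   order m together with one more vertex, adjacent to at least six but not to
   all of its vertices, gains at least m + 1.  Cutting the Hamiltonian cycle greedily
   into pieces of the second kind leaves only one last clique, hence a total
   loss of at most 1. *)
Require Import Defs.
From HB Require Import structures.
From mathcomp Require Import all_boot all_order all_algebra.
From mathcomp Require Import polyrcf reals.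
From mathcomp Require Import complex spectral ring lra zify.
Import Order.TTheory GRing.Theory Num.Theory.
Local Open Scope ring_scope.

Set Implicit Arguments.
Unset Strict Implicit.
Unset Printing Implicit Defensive.

(** * Characteristic polynomials and eigenvalue lists *)

Lemma char_poly_conj (F : fieldType) (n : nat) (P A : 'M[F]_n) :
  P \in unitmx -> char_poly (invmx P *m A *m P) = char_poly A.
Proof.
move=> Pu; pose Q := map_mx (@polyC F) P; pose Q' := map_mx (@polyC F) (invmx P).
have QQ : Q' *m Q = 1%:M by rewrite -map_mxM mulVmx // map_mx1.
have -> : char_poly (invmx P *m A *m P) = \det (Q' *m char_poly_mx A *m Q).
  rewrite /char_poly /char_poly_mx !map_mxM mulmxBr mulmxBl; congr (\det (_ - _)).
  by rewrite scalar_mxC -mulmxA QQ mulmx1.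
by rewrite !det_mulmx mulrAC -det_mulmx QQ det1 mul1r.
Qed.

(** The multiplicity of a root of a product of linear factors is its number of occurrences in [s].
    Hence the diagonal entries found by the spectral theorem are the eigenvalue list up to order. *)
Lemma real_eigenvalues_split (R : rcfType) (n : nat) (A : 'M[R]_n) (s : seq R) :
  char_poly A = \prod_(x <- s) ('X - x%:P) -> perm_eq (real_eigenvalues A) s.
Proof.
move=> As; rewrite /real_eigenvalues As.
under eq_map => x do rewrite mu_prod_XsubC.
apply: perm_trans (perm_count_undup s); apply/perm_flatten/perm_map.
apply: uniq_perm; rewrite ?undup_uniq ?uniq_roots // => x.
rewrite mem_undup -roots_on_rootsR ?monic_neq0 ?monic_prod_XsubC //.
by rewrite in_itv /= root_prod_XsubC.
Qed.

(** * Positive semidefinite matrices and the gain *)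

Lemma trace_mulmxE (R : comNzRingType) (m n : nat) (M : 'M[R]_(m, n)) (N : 'M_(n, m)) :
  \tr (M *m N) = \sum_i \sum_j M i j * N j i.
Proof. by apply: eq_bigr => i _; rewrite mxE. Qed.

(** Gram form with any number of rows: sums come from stacking factors, and diagonal entries in a
    unitary basis are visibly nonnegative. *)
Definition psd (R : nzRingType) (n : nat) (Y : 'M[R]_n) : Prop :=
  exists m (B : 'M[R]_(m, n)), Y = B^T *m B.

(** For symmetric [A] and [Y] this is the drop in squared Frobenius norm from [A] to [A + Y]. *)
Definition gain (R : nzRingType) (n : nat) (A Y : 'M[R]_n) : R :=
  - (2 * \tr (A *m Y)) - \tr (Y *m Y).

Local Open Scope sesquilinear_scope.

(* In an orthonormal eigenbasis of A the gain is at most the sum of the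
   -2 x y - y^2 over the eigenvalues x, with y >= 0 a diagonal entry of Y;
   such a term is at most x^2, and at most 0 when x >= 0. *)
Lemma gain_le_negative_square_energy (R : rcfType) (n : nat) (A Y : 'M[R]_n) :
  A^T = A -> psd Y ->
  gain A Y <= \sum_(x <- real_eigenvalues A | x < 0) x ^+ 2.
Proof.
move=> As [m [B YB]].
(* Diagonalization takes place over [R[i]], where the real symmetric [A] becomes Hermitian. *)
pose f := real_complex R : {rmorphism R -> R[i]}.
pose AC : 'M[R[i]]_n := map_mx f A.
pose P := spectralmx AC; pose sp := spectral_diag AC.
have ACherm : AC \is hermsymmx.
  apply: realsym_hermsym.
    apply/is_hermitianmxP; rewrite expr0 scale1r map_mx_id //.
    by rewrite /AC map_trmx As.
  by apply/mxOverP => i j; rewrite mxE; apply/complex_realP; exists (A i j).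
have Pu : P \in unitmx by exact: spectral_unit.
have PU : invmx P = P^t* by apply: invmx_unitary; exact: spectral_unitarymx.
have AE : AC = invmx P *m diag_mx sp *m P.
  by apply/orthomx_spectralP/hermitian_normalmx.
pose x i := complex.Re (sp 0 i).
have spx i : sp 0 i = f (x i).
  rewrite /f /= RRe_real //.
  by have /mxOverP := hermitian_spectral_diag_real ACherm; apply.
(* The diagonal form gives the factorization over [R[i]]; as its roots are real, it pulls back along
   the injective [f]. *)
have /real_eigenvalues_split eigA :
    char_poly A = \prod_(y <- [seq x i | i <- enum 'I_n]) ('X - y%:P).
  apply: (map_poly_inj f); rewrite map_char_poly -/AC AE char_poly_conj //.
  rewrite char_poly_trig ?diag_mx_is_trig // big_map enumT rmorph_prod /=.
  apply: eq_bigr => i _.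
  by rewrite mxE eqxx mulr1n spx rmorphB /= map_polyX map_polyC.
rewrite (perm_big _ eigA) /= big_map enumT big_mkcond /=.
(* [Z] is [Y] in the eigenbasis; its Gram form makes it Hermitian with nonnegative diagonal. *)
pose W := P *m (map_mx f B)^T.
pose Z := W *m W^t*.
have ZE : Z = P *m map_mx f Y *m invmx P.
  rewrite /Z /W PU trmx_mul map_mxM trmxK YB map_mxM map_trmx -!mulmxA.
  congr (_ *m (_ *m (_ *m _))).
  by apply/matrixP => i j; rewrite !mxE; apply/CrealP/complex_realP; exists (B i j).
have Zherm k l : Z l k = (Z k l)^*.
  rewrite !mxE rmorph_sum /=; apply: eq_bigr => a _.
  by rewrite !mxE rmorphM /= conjCK mulrC.
pose y i := complex.Re (Z i i).
have Zy i : Z i i = f (y i).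
  by rewrite /f /= RRe_real // CrealE -Zherm.
have y_ge0 i : 0 <= y i.
  rewrite -ler0c -/(f _) -Zy mxE sumr_ge0 // => a _.
  by rewrite !mxE mul_conjC_ge0.
have trAY : \tr (A *m Y) = \sum_i x i * y i.
  apply: (fmorph_inj f); rewrite -trace_map_mx map_mxM -/AC AE.
  rewrite -!mulmxA mxtrace_mulC -!mulmxA (mulmxA P) -ZE trace_mulmxE.
  rewrite rmorph_sum; apply: eq_bigr => i _.
  rewrite (bigD1 i) //= big1 => [|j ji]; last by rewrite mxE eq_sym (negPf ji) mul0r.
  by rewrite addr0 mxE eqxx mulr1n spx Zy rmorphM.
(* The trace of [Z *m Z] is the sum of all [|Z i j|^2]; dropping the off-diagonal terms can only
   decrease it. *)
have trYY : \sum_i y i ^+ 2 <= \tr (Y *m Y).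
  rewrite -lecR -/(f _) -/(f (\tr _)) -trace_map_mx map_mxM.
  have -> : \tr (map_mx f Y *m map_mx f Y) = \tr (Z *m Z).
    have -> : Z *m Z = P *m (map_mx f Y *m map_mx f Y) *m invmx P.
      by rewrite ZE !mulmxA mulmxKV.
    by rewrite [in RHS]mxtrace_mulC mulmxA mulVmx // mul1mx.
  rewrite trace_mulmxE rmorph_sum; apply: ler_sum => i _.
  rewrite (bigD1 i) //= Zy -rmorphM -expr2 lerDl sumr_ge0 // => j _.
  by rewrite (Zherm i j) mul_conjC_ge0.
rewrite /gain trAY.
apply: (@le_trans _ _ (\sum_i (- (2 * (x i * y i)) - y i ^+ 2))).
  by rewrite sumrB sumrN -mulr_sumr lerB.
apply: ler_sum => i _; case: ltP => xi.
  by rewrite -subr_ge0 [leRHS](_ : _ = (x i + y i) ^+ 2) ?sqr_ge0 //; ring.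
by rewrite subr_le0 (le_trans _ (sqr_ge0 _)) // oppr_le0 !mulr_ge0.
Qed.

(** * Additivity of the gain over disjoint supports *)

Section Gain.

Variables (R : rcfType) (n : nat).
Implicit Types (A Y : 'M[R]_n) (S T : {set 'I_n}) (u v w : 'rV[R]_n).

Lemma psd0 : psd (0 : 'M[R]_n).
Proof. by exists 0%N, 0; rewrite mulmx0. Qed.

Lemma psdD Y Z : psd Y -> psd Z -> psd (Y + Z).
Proof.
move=> [p [B ->]] [q [C ->]]; exists (p + q)%N, (col_mx B C).
by rewrite tr_col_mx mul_row_col.
Qed.

Lemma psd_rank1 (a : R) w : 0 <= a -> psd (a *: (w^T *m w)).
Proof.
move=> a0; exists 1%N, (Num.sqrt a *: w).
by rewrite [(_ *: w)^T]linearZ /= -scalemxAl -scalemxAr scalerA -expr2 sqr_sqrtr.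
Qed.

Lemma gain0 A : gain A 0 = 0.
Proof. by rewrite /gain !mulmx0 mxtrace0 mulr0 oppr0 addr0. Qed.

Lemma gainD A Y Z : \tr (Y *m Z) = 0 -> gain A (Y + Z) = gain A Y + gain A Z.
Proof.
move=> YZ; rewrite /gain mulmxDr !mulmxDl !mulmxDr !mxtraceD (mxtrace_mulC Z Y) YZ.
ring.
Qed.

Definition supported S Y := forall i j, Y i j != 0 -> (i \in S) && (j \in S).

Lemma supportedS S T Y : S \subset T -> supported S Y -> supported T Y.
Proof. by move=> /subsetP ST YS i j /YS /andP[/ST -> /ST ->]. Qed.

Lemma supportedD S Y Z : supported S Y -> supported S Z -> supported S (Y + Z).
Proof.
move=> YS ZS i j; rewrite mxE; case: (eqVneq (Y i j) 0) => [->|/YS //].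
by rewrite add0r => /ZS.
Qed.

Lemma trace_mul_disjoint S T Y Z :
  [disjoint S & T] -> supported S Y -> supported T Z -> \tr (Y *m Z) = 0.
Proof.
move=> ST YS ZT; rewrite trace_mulmxE big1 // => i _; rewrite big1 // => j _.
case: (eqVneq (Y i j) 0) => [->|/YS /andP[_ jS]]; first by rewrite mul0r.
case: (eqVneq (Z j i) 0) => [->|/ZT /andP[jT _]]; first by rewrite mulr0.
by have := disjointFr ST jS; rewrite jT.
Qed.

(** The support is recorded so that certificates on disjoint vertex sets can be added. *)
Definition gain_on A S (c : R) := exists Y, [/\ psd Y, supported S Y & c <= gain A Y].

Lemma gain_on0 A : gain_on A set0 0.
Proof.
by exists 0; split; [exact: psd0 | move=> i j; rewrite mxE eqxx | rewrite gain0].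
Qed.

Lemma gain_onU A S T (c d : R) : [disjoint S & T] ->
  gain_on A S c -> gain_on A T d -> gain_on A (S :|: T) (c + d).
Proof.
move=> ST [Y [Yp YS Yc]] [Z [Zp ZT Zd]]; exists (Y + Z); split.
- exact: psdD.
- by apply: supportedD; [apply: supportedS YS | apply: supportedS ZT];
    rewrite ?subsetUl ?subsetUr.
- by rewrite gainD ?lerD // (trace_mul_disjoint ST).
Qed.

(** * Quadratic forms on indicator vectors *)

Definition indicator S : 'rV[R]_n := \row_i (i \in S)%:R.

Definition form A u v : R := \tr (u *m A *m v^T).

Lemma form_indicator A S T :
  form A (indicator S) (indicator T) = \sum_(i in S) \sum_(j in T) A i j.
Proof.
rewrite /form -mulmxA mxtrace_mulC trace_mulmxE [RHS]big_mkcond /=.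
apply: eq_bigr => i _; rewrite big_ord1 !mxE mulr_natr mulrb; case: ifP => // _.
by rewrite [RHS]big_mkcond /=; apply: eq_bigr => j _; rewrite !mxE mulr_natr mulrb.
Qed.

(** Three vectors suffice: the test vector used below is a combination of the indicators of two
    cliques and of one vertex. *)
Lemma form_quadratic A (a b c : R) u v w : A^T = A ->
  form A (a *: u + b *: v + c *: w) (a *: u + b *: v + c *: w) =
  a ^+ 2 * form A u u + b ^+ 2 * form A v v + c ^+ 2 * form A w w +
  2 * (a * b * form A u v + a * c * form A u w + b * c * form A v w).
Proof.
move=> As; have sym x y : form A x y = form A y x.
  by rewrite /form -[LHS]mxtrace_tr !trmx_mul trmxK As mulmxA.
have fDl x y z : form A (x + y) z = form A x z + form A y z.
  by rewrite /form !mulmxDl mxtraceD.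
have fZl k x y : form A (k *: x) y = k * form A x y.
  by rewrite /form -!scalemxAl mxtraceZ.
have fDr z x y : form A z (x + y) = form A z x + form A z y.
  by rewrite sym fDl !(sym _ z).
have fZr k x y : form A y (k *: x) = k * form A y x by rewrite sym fZl sym.
by rewrite !(fDl, fDr, fZl, fZr) (sym v u) (sym w u) (sym w v); ring.
Qed.

Lemma gain_rank1 A (a : R) w :
  gain A (a *: (w^T *m w)) = - (2 * a * form A w w) - (a * form 1%:M w w) ^+ 2.
Proof.
have trw (M : 'M[R]_n) : \tr (M *m (w^T *m w)) = form M w w.
  by rewrite mulmxA mxtrace_mulC /form mulmxA.
rewrite /gain -!scalemxAr -!scalemxAl !mxtraceZ trw.
rewrite (_ : \tr (w^T *m w *m (w^T *m w)) = form 1%:M w w ^+ 2); first by ring.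
rewrite trw /form mulmx1 !mulmxA -[w *m w^T *m w *m w^T]mulmxA.
by rewrite [w *m w^T]mx11_scalar -scalar_mxM !mxtrace_scalar expr2.
Qed.

(** * The projection attached to a clique *)

(** For nonempty [S], the orthogonal projection onto the vectors supported on [S] with coordinate
    sum 0: restrict to [S], then subtract the mean. *)
Definition centering S : 'M[R]_n :=
  diag_mx (indicator S) - #|S|%:R^-1 *: ((indicator S)^T *m indicator S).

Lemma centeringE S i j : centering S i j =
  ((i == j) && (i \in S))%:R - #|S|%:R^-1 * ((i \in S) && (j \in S))%:R.
Proof.
rewrite !mxE big_ord1 !mxE -natrM mulnb; congr (_ - _).
by case: (i == j); rewrite ?mulr1n ?mulr0n //; case: eqP => // ->.
Qed.

Lemma supported_centering S : supported S (centering S).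
Proof.
move=> i j; rewrite centeringE; apply: contra_neqT => /nandP[]/negPf nS.
  by rewrite nS andbF mulr0 subr0.
by rewrite nS andbF mulr0 subr0; case: eqP => // ->; rewrite nS.
Qed.

Lemma tr_centering S : (centering S)^T = centering S.
Proof. by rewrite linearB linearZ /= tr_diag_mx trmx_mul trmxK. Qed.

Lemma indicator_diag S T : indicator S *m diag_mx (indicator T) = indicator (S :&: T).
Proof.
by apply/rowP => i; rewrite mul_mx_diag !mxE in_setI -natrM mulnb.
Qed.

Lemma indicator_dot S T : indicator S *m (indicator T)^T = #|S :&: T|%:R%:M.
Proof.
apply/matrixP => i j; rewrite !ord1 !mxE eqxx mulr1n -sum1_card natr_sum.
rewrite [RHS]big_mkcond /=.
by apply: eq_bigr => k _; rewrite !mxE in_setI -natrM mulnb; case: (_ && _).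
Qed.

Lemma indicator_centering S T :
  indicator T *m centering S =
  indicator (T :&: S) - (#|T :&: S|%:R / #|S|%:R) *: indicator S.
Proof.
rewrite mulmxBr indicator_diag -scalemxAr mulmxA indicator_dot mul_scalar_mx.
by rewrite scalerA mulrC.
Qed.

Lemma indicator_centering_self S : (0 < #|S|)%N -> indicator S *m centering S = 0.
Proof.
move=> S0; rewrite indicator_centering setIid divff ?scale1r ?subrr //.
by rewrite pnatr_eq0 -lt0n.
Qed.

Lemma indicator_centering_disjoint S T :
  [disjoint T & S] -> indicator T *m centering S = 0.
Proof.
rewrite -setI_eq0 => /eqP TS; rewrite indicator_centering TS cards0 mul0r scale0r subr0.
by apply/rowP => i; rewrite !mxE in_set0.
Qed.

Lemma diag_centering S : diag_mx (indicator S) *m centering S = centering S.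
Proof.
apply/matrixP => i j; rewrite mul_diag_mx mxE [indicator S 0 i]mxE.
have := @supported_centering S i j; case: (i \in S) => /=; first by rewrite mul1r.
by move=> h; rewrite mul0r; case: eqP h => [->|_ /(_ isT)].
Qed.

Lemma centering_idem S : (0 < #|S|)%N -> centering S *m centering S = centering S.
Proof.
move=> S0; rewrite {1}/centering mulmxBl diag_centering -scalemxAl -mulmxA.
by rewrite indicator_centering_self // mulmx0 scaler0 subr0.
Qed.

Lemma psd_centering S : (0 < #|S|)%N -> psd (centering S).
Proof. by move=> S0; exists n, (centering S); rewrite tr_centering centering_idem. Qed.

Lemma trace_centering S : (0 < #|S|)%N -> \tr (centering S) = #|S|%:R - 1.
Proof.
move=> S0; rewrite raddfB /= mxtraceZ mxtrace_mulC indicator_dot setIid mxtrace_scalar.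
rewrite mulVf ?pnatr_eq0 -?lt0n // mxtrace_diag -sum1_card natr_sum.
rewrite [in RHS]big_mkcond /=.
by congr (_ - _); apply: eq_bigr => i _; rewrite mxE; case: (i \in S).
Qed.

(** On a clique [A] is J - I, and the all-ones matrix J kills the range of the projection. So [A]
    acts there as -1, and the gain is twice the trace of the projection minus that trace. *)
Lemma gain_centering A S : (0 < #|S|)%N ->
  {in S &, forall i j, A i j = (i != j)%:R} -> gain A (centering S) = #|S|%:R - 1.
Proof.
move=> S0 AS; rewrite /gain centering_idem //.
suff -> : \tr (A *m centering S) = - \tr (centering S).
  by rewrite trace_centering //; ring.
have AE : diag_mx (indicator S) *m A *m diag_mx (indicator S) =
    (indicator S)^T *m indicator S - diag_mx (indicator S).
  apply/matrixP => i j; rewrite mul_mx_diag mul_diag_mx !mxE big_ord1 !mxE.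
  case: (boolP (i \in S)) (boolP (j \in S)) => iS [] jS.
  - rewrite AS // !mul1r mulr1; case: eqVneq; rewrite ?mulr1n ?mulr0n ?subrr ?subr0 //.
  - by rewrite !mulr0 sub0r; case: eqP jS => [<-|]; rewrite ?iS ?mulr0n ?oppr0.
  - by rewrite !mul0r mul0rn subr0.
  - by rewrite !mul0r mul0rn subr0.
have CE : centering S = diag_mx (indicator S) *m centering S *m diag_mx (indicator S).
  rewrite diag_centering -[RHS]trmxK trmx_mul tr_diag_mx tr_centering.
  by rewrite diag_centering tr_centering.
rewrite {1}CE mulmxA mxtrace_mulC !mulmxA AE mulmxBl -mulmxA.
by rewrite indicator_centering_self // mulmx0 sub0r diag_centering raddfN.
Qed.

End Gain.

(** * A clique with one additional vertex *)

Lemma supported_rank1 (R : rcfType) (n : nat) (a : R) (w : 'rV[R]_n) (S : {set 'I_n}) :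
  (forall i, w 0 i != 0 -> i \in S) -> supported S (a *: (w^T *m w)).
Proof.
move=> wS i j; rewrite !mxE big_ord1 !mxE !mulf_eq0 !negb_or => /and3P[_ wi wj].
by rewrite !wS.
Qed.

(** In the application [N] is the squared norm of the test vector, [-(2 + N)] its value under the
    form of [A], and [2 / N] the rank-one coefficient, which makes the squared term equal to 4. The
    rank-one gain is then 8/N. It must be at least 3, to turn the loss of 2 from two cliques into a
    surplus of 1. This means N <= 8/3, with equality at d = 6, r = 1. *)
Lemma near_clique_value (R : realFieldType) (d r : R) (N := 4 / d + r^-1 + 1) :
  6 <= d -> 1 <= r ->
  0 < N /\
  d + r + 1 <= d - 1 + (r - 1) + (- (2 * (2 / N) * - (2 + N)) - (2 / N * N) ^+ 2).
Proof.
move=> d6 r1.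
have N1 : 1 <= N by rewrite lerDr addr_ge0 ?invr_ge0 ?divr_ge0 //; lra.
have N2 : N <= 8 / 3.
  have d1 : 4 / d <= 2 / 3 by rewrite ler_pdivrMr; lra.
  have r2 : r^-1 <= 1 by rewrite invf_le1; lra.
  by rewrite /N; lra.
split; first by lra.
rewrite divfK; last by lra.
have -> : - (2 * (2 / N) * - (2 + N)) = 8 / N + 4 by field; lra.
have : 3 <= 8 / N by rewrite ler_pdivlMr; lra.
by lra.
Qed.

(* Test matrix: the projections of the cliques D and E, plus a multiple of
   w^T w, where w = 2/#|D| on D, -1/#|E| on E, -1 at v has coordinate sum 0.
   The missing edges between v and E make the Rayleigh quotient of A at w
   less than - sqrt 3. *)
Lemma gain_near_clique (R : rcfType) (n : nat) (A : 'M[R]_n) (D E : {set 'I_n})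
    (v : 'I_n) :
  A^T = A -> A v v = 0 -> {in D :|: E &, forall i j, A i j = (i != j)%:R} ->
  {in D, forall i, A i v = 1} -> {in E, forall i, A i v = 0} ->
  [disjoint D & E] -> v \notin D :|: E -> (5 < #|D|)%N -> (0 < #|E|)%N ->
  gain_on A (v |: (D :|: E)) (#|D|%:R + #|E|%:R + 1).
Proof.
move=> As Avv ADE ADv AEv dDE; rewrite in_setU negb_or => /andP[vD vE] D5 E0.
have D0 : (0 < #|D|)%N by apply: leq_trans D5.
have dDv : [disjoint D & [set v]] by rewrite disjoint_sym disjoints1.
have dEv : [disjoint E & [set v]] by rewrite disjoint_sym disjoints1.
pose d : R := #|D|%:R; pose r : R := #|E|%:R.
have d6 : 6 <= d by rewrite /d ler_nat.
have r1 : 1 <= r by rewrite /r ler1n.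
have dn0 : d != 0 by rewrite pnatr_eq0 -lt0n.
have rn0 : r != 0 by rewrite pnatr_eq0 -lt0n.
have AD : {in D &, forall i j, A i j = (i != j)%:R}.
  by move=> i j iD jD; rewrite ADE // in_setU ?iD ?jD.
have AE : {in E &, forall i j, A i j = (i != j)%:R}.
  by move=> i j iD jD; rewrite ADE // in_setU ?iD ?jD orbT.
pose w := (2 / d) *: indicator R D + (- r^-1) *: indicator R E
          + (-1) *: indicator R [set v].
have cst (M : 'M[R]_n) (S T : {set 'I_n}) (c : R) :
    {in S & T, forall i j, M i j = c} ->
    form M (indicator R S) (indicator R T) = #|S|%:R * (#|T|%:R * c).
  move=> Mc; rewrite form_indicator mulr_natl -sumr_const; apply: eq_bigr => i iS.
  by rewrite mulr_natl -sumr_const; apply: eq_bigr => j jT; exact: Mc.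
have clq (S : {set 'I_n}) : {in S &, forall i j, A i j = (i != j)%:R} ->
    form A (indicator R S) (indicator R S) = #|S|%:R * (#|S|%:R - 1).
  move=> AS; rewrite form_indicator mulr_natl -sumr_const; apply: eq_bigr => i iS.
  rewrite (bigD1 i) //= AS // eqxx add0r (cardD1 i) iS natrD addrC addKr.
  rewrite -sumr_const; apply: eq_big => [j|j /andP[jS ji]]; first by rewrite !inE andbC.
  by rewrite AS // eq_sym ji.
have one (S : {set 'I_n}) : form 1%:M (indicator R S) (indicator R S) = #|S|%:R.
  by rewrite /form mulmx1 indicator_dot setIid mxtrace_scalar.
have one0 (S T : {set 'I_n}) : [disjoint S & T] ->
    form 1%:M (indicator R S) (indicator R T) = 0.
  rewrite /form mulmx1 indicator_dot -setI_eq0 => /eqP ->.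
  by rewrite cards0 mxtrace_scalar.
have Nw : form 1%:M w w = 4 / d + r^-1 + 1.
  rewrite form_quadratic ?tr_scalar_mx // !one !one0 // cards1 -/d -/r.
  by field; rewrite dn0 rn0.
(* If [v] were adjacent to all of [E], the value would be minus the squared norm, as for any vector
   of sum 0 on a clique. The missing edges lower it by 2, since [w] is -1/r on [E] and -1 at [v]. *)
have Aw : form A w w = - (2 + form 1%:M w w).
  rewrite Nw form_quadratic // !clq //; last first.
    by move=> i j /set1P -> /set1P ->; rewrite Avv eqxx.
  rewrite (cst _ D E 1) ?(cst _ D [set v] 1) ?(cst _ E [set v] 0) ?cards1;
    rewrite -?/d -?/r; last first.
  - move=> i j iD jE; rewrite ADE ?in_setU ?iD ?jE ?orbT //.
    by case: eqP => // ij; have := disjointFr dDE iD; rewrite ij jE.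
  - by move=> i j iD /set1P ->; rewrite ADv.
  - by move=> i j iE /set1P ->; rewrite AEv.
  by field; rewrite dn0 rn0.
pose c := 2 / form 1%:M w w.
have [N0 value] := near_clique_value d6 r1; rewrite -Nw in N0 value.
have c0 : 0 <= c by rewrite divr_ge0 // ltW.
(* [w] is constant on [D] and on [E], so the rank-one term is orthogonal to both projections and the
   gains add. *)
have wD : w *m centering R D = 0.
  by rewrite !mulmxDl -!scalemxAl indicator_centering_self //
     !indicator_centering_disjoint // ?scaler0 ?addr0 // disjoint_sym.
have wE : w *m centering R E = 0.
  by rewrite !mulmxDl -!scalemxAl indicator_centering_self //
     !indicator_centering_disjoint // ?scaler0 ?addr0 // disjoint_sym.
exists (centering R D + centering R E + c *: (w^T *m w)); split.
- by apply: psdD; [apply: psdD; exact: psd_centering | exact: psd_rank1].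
- apply: supportedD; first apply: supportedD.
  + by apply: supportedS (@supported_centering _ _ D); rewrite setUC -setUA subsetUl.
  + by apply: supportedS (@supported_centering _ _ E); rewrite setUA subsetUr.
  + apply: supported_rank1 => i; rewrite !mxE !in_setU in_set1; apply: contra_neqT.
    by rewrite !negb_or => /and3P[/negPf-> /negPf-> /negPf->]; rewrite !mulr0 !addr0.
- rewrite gainD; last first.
    rewrite -scalemxAr mulmxA mxtraceZ mxtrace_mulC mulmxA mulmxDr wD wE.
    by rewrite addr0 mul0mx mxtrace0 mulr0.
  rewrite gainD; last by apply: (trace_mul_disjoint dDE); exact: supported_centering.
  by rewrite !gain_centering // gain_rank1 Aw -/d -/r /c value.
Qed.

(** * Greedy decomposition of a path power *)

Lemma gain_on_le (R : rcfType) (n : nat) (A : 'M[R]_n) (S : {set 'I_n}) (c d : R) :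
  c <= d -> gain_on A S d -> gain_on A S c.
Proof. by move=> cd [Y [Yp YS Yd]]; exists Y; split=> //; apply: le_trans Yd. Qed.

Lemma pairwise_symmetric (T : eqType) (g : rel T) (s : seq T) :
  symmetric g -> pairwise g s -> {in s &, forall x y, x != y -> g x y}.
Proof.
move=> gsym; elim: s => //= z s IH /andP[/allP gz /IH gs] x y; rewrite !inE.
move=> /predU1P[->|xs] /predU1P[->|ys] xy; rewrite ?eqxx // in xy *.
- exact: gz.
- by rewrite gsym gz.
- exact: gs.
Qed.

(* Greedy decomposition: the longest prefix of s that is a clique, followed by
   the next vertex of s, gains its full size; only the last piece, if it is a
   clique, loses 1. *)
Lemma gain_path_power (R : rcfType) (n k : nat) (g : rel 'I_n) (s : seq 'I_n) :
  symmetric g -> irreflexive g -> (5 < k)%N -> uniq s ->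
  (forall x0 i j, (i < j < size s)%N -> (j - i <= k)%N ->
     g (nth x0 s i) (nth x0 s j)) ->
  gain_on (\matrix_(i, j) (g i j)%:R : 'M[R]_n) [set x in s] ((size s)%:R - 1).
Proof.
move=> gsym girr k5; have [m] := ubnP (size s); elim: m s => // m IH s sm us gs.
set A := (X in gain_on X).
have AE i j : A i j = (g i j)%:R by rewrite mxE.
have clique t : pairwise g t -> {in t &, forall i j, A i j = (i != j)%:R}.
  move=> gt i j it jt; rewrite AE; case: eqVneq => [->|ij]; first by rewrite girr.
  by rewrite (pairwise_symmetric gsym gt).
have [gt|ngs] := boolP (pairwise g s).
  (* An empty remainder only has to gain -1, so the zero matrix serves. *)
  case: (posnP (size s)) => [/size0nil s0|s0].
    have -> : [set x in s] = set0 by rewrite s0; apply/setP => x; rewrite !inE.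
    by apply: gain_on_le (gain_on0 _); rewrite s0 sub0r lerN10.
  have cs : #|[set x in s]| = size s by rewrite cardsE; apply/card_uniqP.
  exists (centering R [set x in s]); split.
  - by apply: psd_centering; rewrite cs.
  - exact: supported_centering.
  - rewrite gain_centering ?cs // => i j; rewrite !inE; exact: clique.
(* The shortest prefix that is not a clique has length [b.+1]; thus the first [b] vertices form a
   clique and position [b] holds the next vertex [v]. *)
have exb : exists b, ~~ pairwise g (take b.+1 s).
  by exists (size s); rewrite take_oversize.
case: (ex_minnP exb) => b nb bmin.
have gb : pairwise g (take b s).
  case: b nb bmin => [|b] _ bmin; first by rewrite take0.
  by apply: contraT => /bmin; rewrite ltnn.
have bs : (b < size s)%N.
  rewrite ltnNge; apply/negP => sb; move: ngs gb; rewrite take_oversize //.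
  by move/negPf=> ->.
have [v0 _] : exists v0 : 'I_n, True by case: (s) bs => // v0; exists v0.
pose v := nth v0 s b; pose K := [set x in take b s]; pose G := [set x | g x v].
have takeS : take b.+1 s = rcons (take b s) v by exact: take_nth.
have uK : uniq (rcons (take b s) v) by rewrite -takeS take_uniq.
have [vK uK'] : v \notin K /\ uniq (take b s).
  by move: uK; rewrite rcons_uniq inE => /andP[].
have cK : #|K| = b by rewrite cardsE (card_uniqP uK') size_takel // ltnW.
have [u uK'' gu] : exists2 u, u \in take b s & ~~ g u v.
  by move: nb; rewrite takeS pairwise_rcons gb andbT => /allPn.
(* A vertex [u] of the prefix not adjacent to [v] must lie more than [k] positions before [v]. *)
have kb : (k < b)%N.
  have ui : (index u (take b s) < b)%N.
    by rewrite -[X in (_ < X)%N](size_takel (ltnW bs)) index_mem.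
  rewrite ltnNge; apply/negP => bk.
  have := gs v0 _ b _ (leq_trans (leq_subr (index u (take b s)) b) bk).
  by rewrite ui bs -(nth_take v0 ui) nth_index // (negPf gu) => /(_ isT).
(* The six positions just before [v] exist because 5 < k < b, and hold neighbours of [v] because
   their distance is at most [k]. *)
have cD : (5 < #|K :&: G|)%N.
  pose f (j : 'I_6) := nth v0 s (b - j.+1).
  have bf (j : 'I_6) : (b - j.+1 < b)%N by have := ltn_ord j; lia.
  have finj : injective f.
    move=> i j /eqP; rewrite nth_uniq ?(ltn_trans (bf _)) // => /eqP ij.
    by apply/val_inj => /=; have := ltn_ord i; have := ltn_ord j; lia.
  rewrite -[6%N]card_ord -(card_imset _ finj).
  apply/subset_leq_card/subsetP => _ /imsetP[j _ ->].
  rewrite !inE /f -(nth_take v0 (bf j)) mem_nth ?size_takel ?bf 1?ltnW //=.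
  rewrite nth_take // gs // ?bf //; have := ltn_ord j; lia.
have cE : (0 < #|K :\: G|)%N by rewrite (cardsD1 u) !inE gu uK''.
have -> : [set x in s] = (v |: (K :&: G :|: K :\: G)) :|: [set x in drop b.+1 s].
  rewrite setID; apply/setP => x; rewrite !inE -{1}(cat_take_drop b.+1 s) mem_cat takeS.
  by rewrite mem_rcons inE.
(* The first piece has b + 1 vertices and gains b + 1; the loss of 1 is passed on to the remaining
   sequence. *)
have -> : (size s)%:R - 1 =
    (#|K :&: G|%:R + #|K :\: G|%:R + 1) + ((size (drop b.+1 s))%:R - 1) :> R.
  by rewrite -natrD cardsID cK size_drop -[in LHS](subnKC bs) natrD -natr1; ring.
apply: gain_onU.
- rewrite setID -setI_eq0; apply/eqP/setP => x; rewrite !inE; apply/negP => /andP[xK xd].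
  have : uniq (take b.+1 s ++ drop b.+1 s) by rewrite cat_take_drop.
  rewrite cat_uniq => /and3P[_ /hasPn /(_ x xd)] /negP []; rewrite takeS mem_rcons inE.
  exact: xK.
- apply: gain_near_clique; rewrite ?setID //.
  + by apply/matrixP => i j; rewrite !mxE gsym.
  + by rewrite AE girr.
  + by move=> i j; rewrite !inE; exact: clique.
  + by move=> i; rewrite !inE AE => /andP[_ ->].
  + by move=> i; rewrite !inE AE => /andP[/negPf ->].
  + by rewrite -setI_eq0; apply/eqP/setP => x; rewrite !inE; case: (g x v); rewrite ?andbF.
- apply: IH; rewrite ?drop_uniq // size_drop; first by lia.
  move=> x0 i j /andP[ij js] ijk; rewrite !nth_drop gs //; lia.
Qed.

Theorem theorem8p2 (R : realType) (V : finType) (e : rel V) (n : nat)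
    (e_sym : symmetric e) (e_irr : irreflexive e) (order_V : #|V| = n)
    (ham16 : has_hamiltonian_cycle_power e 16) :
  n%:R - 1 <= s_minus R e.
Proof.
have [phi phi_bij phiP] := ham16.
pose g : rel 'I_#|V| := fun i j => e (enum_val i) (enum_val j).
(* The vertices in cycle order, as indices of the adjacency matrix. *)
pose s := [seq enum_rank (phi i) | i <- enum 'I_#|V|].
have nth_s x0 i (lt_i : (i < #|V|)%N) : enum_val (nth x0 s i) = phi (Ordinal lt_i).
  rewrite (nth_map (Ordinal lt_i)) ?size_enum_ord // enum_rankK.
  by congr phi; apply/val_inj; rewrite /= nth_enum_ord.
have size_s : size s = n by rewrite size_map size_enum_ord.
have [] := @gain_path_power R _ 16 g s.
- by move=> i j; exact: e_sym.
- by move=> i; exact: e_irr.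
- by [].
- by rewrite map_inj_uniq ?enum_uniq //; exact: inj_comp enum_rank_inj (bij_inj phi_bij).
(* Positions i < j differ by the cyclic shift j - i, so [phiP] applies to that shift. *)
- move=> x0 i j /andP[ij]; rewrite size_s -order_V => lt_j ji.
  rewrite /g (nth_s _ _ lt_j) (nth_s _ _ (ltn_trans ij lt_j)).
  by apply: (phiP _ _ (j - i)%N) => /=; [rewrite subn_gt0 ij | rewrite subnKC // ltnW].
move=> Y [Yp _]; rewrite size_s => Yn; apply: le_trans Yn _.
apply: gain_le_negative_square_energy Yp.
by apply/matrixP => i j; rewrite !mxE /g e_sym.
Qed.
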